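(* Fix an integer $d\ge 1$ and a periodic set $\mathbf{A}=(A,t_A)$, where $t_A\ge 1$ is an integer and $A=\{a_0,a_1,\dots,a_k\}$ with $0=a_0<a_1<\dots<a_k<t_A$. Then the formal power series $P^r(\mathbf{A},t)$, $r\in A$, satisfy the system of linear equations in $\mathbb{Q}[\![t]\!]$ $$P^r(\mathbf{A},t)-\sum_{q\in A}\,[E(t)]_{t_A,\,Sh(r,q)}\;P^q(\mathbf{A},t)=E^{\infty}(t),\qquad r\in A,$$ and this system (with the $P^r(\mathbf{A},t)$, $r\in A$, as unknowns) has a unique solution in $\mathbb{Q}[\![t]\!]$.
   Context: A directed lattice path (DLP) in $\mathbb{Z}_{\ge 0}\times\mathbb{Z}^d$ (first coordinate = ''time'', the set $\{(x,0):x\ge0\}$ with $0\in\mathbb{Z}^d$ is the $T$-axis) is a sequence of lattice points in which each step is of the form $(1,s)$ with $s\in\{-1,1\}^d$; its length is its number of steps. Two DLPs are equal iff they have the same starting point and the same sequence of steps. Only DLPs of even length are considered, and generating functions are ordinary generating functions in which the exponent of $t$ is half the length of the path. For the periodic set $\mathbf{A}=(A,t_A)$, a point $(2m,0)$ of the $T$-axis is called admissible if $m \bmod t_A\in A$. For $r\in A$, $P^r(\mathbf{A},t)=\sum_{n\ge0}p_nt^n$, where $p_n$ is the number of DLPs of length $2n$ starting at $(2r,0)$ all of whose points lying on the $T$-axis are admissible. $E(t)=\sum_{n\ge1}e_nt^n$, where $e_n$ is the number of DLPs of length $2n$ (no restrictions) starting at the origin, ending on the $T$-axis and not touching the $T$-axis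 at any intermediate point (primitive $T$-excursions). $E^{\infty}(t)=\sum_{n\ge0}f_nt^n$, where $f_n$ is the number of DLPs of length $2n$ (no restrictions) starting at the origin that never return to the $T$-axis after time $0$ (escaping paths). For $G(t)=\sum_i g_it^i$ and integers $0\le r<q$, the multisection is $[G(t)]_{q,r}=\sum_{i\ge0}g_{qi+r}t^{qi+r}$. For $j,q\in\{0,\dots,t_A-1\}$, $Sh(j,q)=q-j$ if $j\le q$ and $Sh(j,q)=t_A+q-j$ if $j>q$ (the distance from $(2j,0)$ to the nearest point $(2y,0)$ with $y\ge j$ and $y\equiv q \pmod{t_A}$, measured in half-lengths). *)

(* Defs.v *)
From mathcomp Require Import all_boot all_order all_algebra.

Set Implicit Arguments.
Unset Strict Implicit.
Unset Printing Implicit Defensive.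

Import GRing.Theory.
Local Open Scope ring_scope.

(* A formal power series over the rationals is given by its coefficients;
   equality of series is coefficientwise equality (=1). *)
Definition fps := nat -> rat.

Definition fps_mul (f g : fps) : fps :=
  fun n => \sum_(i < n.+1) f i * g (n - i)%N.

(* [G]_{q,r}; for r < q the exponents q * i + r are those congruent to r. *)
Definition multisection (G : fps) (q r : nat) : fps :=
  fun n => if (n %% q == r)%N then G n else 0.

Definition point (d : nat) := (nat * 'rV[int]_d)%type.

(* s stands for the lattice step (1, v) with v_j = 1 if s j and -1 otherwise. *)
Definition step (d : nat) := {ffun 'I_d -> bool}.

Definition move (d : nat) (x : point d) (s : step d) : point d :=
  (x.1.+1, x.2 + \row_j (if s j then 1 else -1)).

(* The directed lattice path starting at x with step sequence s visits x and
   then the points of [visited x s]; since a path is determined by x and s,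
   paths from x are counted by counting step sequences. *)
Definition visited (d : nat) (x : point d) (s : seq (step d)) : seq (point d) :=
  scanl (@move d) x s.

Definition intermediate (d : nat) (x : point d) (s : seq (step d)) :
    seq (point d) :=
  behead (belast x (visited x s)).

Definition on_Taxis (d : nat) (x : point d) : bool := x.2 == 0.

Definition axis_point (d m : nat) : point d := (m, 0).

(* Exponents are half-lengths. *)
Definition path_gf (d : nat) (Q : pred (seq (step d))) : fps :=
  fun n => #|[set s : n.*2.-tuple (step d) | Q s]|%:R.

(* A periodic set (A, t) is given by its period t and A : {set 'I_t}. *)
Definition admissible (d t : nat) (A : {set 'I_t}) (x : point d) : bool :=
  [&& on_Taxis x, ~~ odd x.1 & [exists a in A, (x.1./2 %% t == a)%N]].

Definition P_series (d t : nat) (A : {set 'I_t}) (r : 'I_t) : fps :=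
  path_gf (fun s : seq (step d) =>
    let x := axis_point d r.*2 in
    all (fun y => on_Taxis y ==> admissible A y) (x :: visited x s)).

Definition E_series (d : nat) : fps :=
  path_gf (fun s : seq (step d) =>
    let x := axis_point d 0 in
    [&& (0 < size s)%N, on_Taxis (last x (visited x s))
      & all (fun y => ~~ on_Taxis y) (intermediate x s)]).

Definition Einf_series (d : nat) : fps :=
  path_gf (fun s : seq (step d) =>
    all (fun y => ~~ on_Taxis y) (visited (axis_point d 0) s)).

Definition Sh (t j q : nat) : nat :=
  if (j <= q)%N then (q - j)%N else (t + q - j)%N.

(* Only the values X r with r \in A are constrained: they are the unknowns. *)
Definition solves_system (d t : nat) (A : {set 'I_t}) (X : 'I_t -> fps) : Prop :=
  forall r : 'I_t, r \in A ->
    (fun n => X r n -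
       \sum_(q in A) fps_mul (multisection (E_series d) t (Sh t r q)) (X q) n)
    =1 Einf_series d.

(* Main.v *)
Require Import Defs.
From mathcomp Require Import all_boot all_order all_algebra.
From mathcomp Require Import zify.

Set Implicit Arguments.
Unset Strict Implicit.
Unset Printing Implicit Defensive.

Import GRing.Theory.

(** The system is the first-return decomposition: an admissible path from
    [(2r, 0)] either escapes, or is a primitive excursion of some length [2i]
    followed by an admissible path from [(2(r + i), 0)].  The latter are counted
    by [P^q] with [q] the residue of [r + i] modulo [t], and [q] is
    characterised by [i] being congruent to [Sh r q].  Uniqueness holds because
    [E] has no constant term, so that the system determines the [n]-th
    coefficients of a solution from the previous ones. *)

(** If nothing in the prefix satisfies [a], then [find] gives its default [m] on the left and at
    least [m] on the right, so both equations fail. *)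
Lemma find_take_eq (T : Type) (a : pred T) (s : seq T) (m : nat) :
  m <= size s -> ((find a (take m s)).+1 == m) = ((find a s).+1 == m).
Proof.
move=> le_m_s; rewrite -{2}(cat_take_drop m s) find_cat size_take_min.
rewrite (minn_idPl le_m_s); case: ifP => // /negbT.
move/hasNfind=> ->; rewrite size_take_min (minn_idPl le_m_s).
by apply/eqP/eqP; lia.
Qed.

(** Concatenation of an [m]-tuple and an [n]-tuple is injective between sets of equal cardinality,
    hence a bijection. *)
Lemma sum_tuple_cat (T : finType) (m n N : nat) (F G : seq T -> nat) :
  N = m + n ->
  \sum_(s : N.-tuple T) F (take m s) * G (drop m s) =
  (\sum_(u : m.-tuple T) F u) * \sum_(v : n.-tuple T) G v.
Proof.
move=> ->; rewrite big_distrlr pair_big /=.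
pose h (p : m.-tuple T * n.-tuple T) := [tuple of p.1 ++ p.2].
rewrite (reindex h) /=.
  apply: eq_bigr => -[u v] _ /=.
  by rewrite take_size_cat ?drop_size_cat ?size_tuple.
apply: onW_bij; apply: inj_card_bij.
  move=> [u v] [u' v'] /(congr1 val) /= /eqP.
  rewrite eqseq_cat ?size_tuple // => /andP[/eqP eu /eqP ev].
  by congr (_, _); apply: val_inj.
by rewrite card_prod !card_tuple expnD.
Qed.

Lemma card_set_sum (T : finType) (Q : pred T) : #|[set s | Q s]| = \sum_s Q s.
Proof. by rewrite -sum1dep_card big_mkcond; apply: eq_bigr => s _; case: (Q s). Qed.

(** * Paths, first returns and primitive excursions *)

Section Paths.

Variable d : nat.
Implicit Types (x y : point d) (s u v : seq (step d)).

Definition shift (k : nat) x : point d := (k + x.1, x.2).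

Lemma visited_shift k x s :
  visited (shift k x) s = [seq shift k y | y <- visited x s].
Proof.
rewrite /visited; elim: s x => //= a s IH x.
have -> : move (shift k x) a = shift k (move x a) by rewrite /move /shift /= addnS.
by rewrite IH.
Qed.

Lemma visited_cat x u v :
  visited x (u ++ v) = visited x u ++ visited (last x (visited x u)) v.
Proof. by rewrite /visited; elim: u x => //= a u IH x; rewrite IH. Qed.

Lemma size_visited x s : size (visited x s) = size s.
Proof. exact: size_scanl. Qed.

Lemma time_last x s : (last x (visited x s)).1 = x.1 + size s.
Proof.
rewrite /visited; elim: s x => [|a s IH] x /=; first by rewrite addn0.
by rewrite IH /= addnS.
Qed.

Lemma visited_take m x s : visited x (take m s) = take m (visited x s).
Proof. by rewrite /visited; elim: s m x => [|a s IH] [|m] x //=; rewrite IH. Qed.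

(** [visited] omits the starting point, so the first return is at time [(return_index s).+1]; the
    value is [size s] if there is no return. *)
Definition return_index s := find (@on_Taxis d) (visited (axis_point d 0) s).

Definition excursion s :=
  let x := axis_point d 0 in
  [&& (0 < size s)%N, on_Taxis (last x (visited x s))
    & all (fun y => ~~ on_Taxis y) (intermediate x s)].

Lemma excursionE s : excursion s = ((return_index s).+1 == size s).
Proof.
rewrite /excursion /return_index /intermediate -(size_visited (axis_point d 0) s).
move: (axis_point d 0) => x; case: (visited x s) => [|y w] //=.
elim: w y => [|z w IH] y /=; first by case: on_Taxis.
by case: (on_Taxis y) => /=; rewrite ?andbF // IH.
Qed.

Lemma excursion_take m s : m <= size s ->
  excursion (take m s) = ((return_index s).+1 == m).
Proof.
move=> le_m; rewrite excursionE size_take_min (minn_idPl le_m).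
by rewrite /return_index visited_take find_take_eq ?size_visited.
Qed.

End Paths.

(** * Returns happen at even times *)

Section Parity.

Variables (d : nat) (hd : (1 <= d)%N).

(* Every coordinate of a position has the parity of the time. *)
Lemma on_Taxis_even (x : point d) (s : seq (step d)) :
  on_Taxis x -> on_Taxis (last x (visited x s)) -> ~~ odd (size s).
Proof.
have parity j (y : point d) : odd `|(last y (visited y s)).2 ord0 j|%N =
    odd (size s) (+) odd `|y.2 ord0 j|%N.
  rewrite /visited; elim: s y => //= a s IH y.
  rewrite IH /= !mxE; case: (a j); move: (y.2 ord0 j) => z; lia.
move=> /eqP x0 /eqP y0; have := parity (Ordinal hd) x.
by rewrite x0 y0 !mxE /= addbF => <-.
Qed.

(** The prefix that ends at the first return is an excursion, so its length [(return_index s).+1] is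
    even. *)
Lemma odd_return_index (s : seq (step d)) :
  return_index s < size s -> odd (return_index s).
Proof.
move=> lt_s; have /(excursion_take)E : (return_index s).+1 <= size s by [].
have on0 : on_Taxis (axis_point d 0) by exact: eqxx.
move: E; rewrite eqxx => /and3P[_ /(on_Taxis_even on0) + _].
by rewrite size_take_min (minn_idPl lt_s) /= negbK.
Qed.

(** A path either escapes or has a unique first return. Since that return is at an even time,
    prefixes of length [i.*2] suffice to detect it. *)
Lemma first_return_sum (s : seq (step d)) (n : nat) : size s = n.*2 ->
  all (fun y => ~~ on_Taxis y) (visited (axis_point d 0) s)
    + \sum_(i < n.+1) excursion (take i.*2 s) = 1.
Proof.
move=> sz_s.
have sumE : \sum_(i < n.+1) excursion (take i.*2 s) =
    \sum_(i < n.+1) ((return_index s).+1 == i.*2).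
  apply: eq_bigr => i _; rewrite excursion_take // sz_s leq_double.
  by have := ltn_ord i.
rewrite sumE all_predC has_find -/(return_index s) size_visited.
case: ltnP => [lt_s | ge_s] /=.
  have odd_f := odd_return_index lt_s.
  have lt_i : (return_index s).+1./2 < n.+1 by lia.
  rewrite (bigD1 (Ordinal lt_i)) //= big1 => [|i /eqP ne_i].
    by have -> : ((return_index s).+1 == (return_index s).+1./2.*2) by lia.
  by case: eqP => // eq_i; case: ne_i; apply: val_inj => /=; lia.
(* Without a return the index is [size s], and its successor exceeds every [i.*2]. *)
have := find_size (@on_Taxis d) (visited (axis_point d 0) s).
rewrite size_visited -/(return_index s) => le_s.
by rewrite big1 // => i _; case: eqP => //; lia.
Qed.

End Parity.

(** * Admissible paths and periodicity *)

Section Admissible.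

Variables (d t : nat) (A : {set 'I_t}).

(** The start [m] is any natural number, because the path left after an excursion starts at [r + i],
    which may exceed the period. *)
Definition good (m : nat) (s : seq (step d)) :=
  let x := axis_point d m.*2 in
  all (fun y => on_Taxis y ==> admissible A y) (x :: visited x s).

(** Admissibility is invariant under translation in time by multiples of [t.*2]. *)
Lemma good_mod m s : good m s = good (m %% t) s.
Proof.
have shiftE : axis_point d m.*2 = shift (m %/ t * t).*2 (axis_point d (m %% t).*2).
  by rewrite /shift /axis_point /= -doubleD -divn_eq.
have adm k (y : point d) : admissible A (shift (k * t).*2 y) = admissible A y.
  rewrite /admissible /shift /= oddD odd_double halfD odd_double /= doubleK.
  congr [&& _, _ & _]; apply: eq_existsb => a.
  by rewrite modnMDl.
rewrite /good shiftE visited_shift -map_cons all_map.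
by apply: eq_all => y /=; rewrite adm.
Qed.

Lemma good_escape (r : 'I_t) s : r \in A ->
  all (fun y => ~~ on_Taxis y) (visited (axis_point d 0) s) -> good r s.
Proof.
move=> Ar escape; have adm_r : admissible A (axis_point d r.*2).
  rewrite /admissible /on_Taxis eqxx /= odd_double doubleK /=.
  by apply/existsP; exists r; rewrite Ar modn_small ?eqxx.
rewrite /good /= adm_r implybT /=.
have -> : axis_point d r.*2 = shift r.*2 (axis_point d 0).
  by rewrite /shift /= addn0.
rewrite visited_shift all_map; apply: sub_all escape => y /= off.
by rewrite /on_Taxis /= -/(on_Taxis y) (negPf off).
Qed.

Lemma good_start m s : good m s -> [exists a in A, (m %% t == a)%N].
Proof.
rewrite /good /= => /andP[+ _].
by rewrite /admissible /on_Taxis eqxx /= odd_double doubleK.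
Qed.

(* The first point of an excursion is admissible, its last point is the first
   point of the remaining path, and the others are off the axis. *)
Lemma good_excursion (r : 'I_t) i u v : r \in A -> size u = i.*2 ->
  excursion u -> good r (u ++ v) = good (r + i) v.
Proof.
move=> Ar sz_u exc_u; rewrite /good /=.
have adm_r : admissible A (axis_point d r.*2).
  rewrite /admissible /on_Taxis eqxx /= odd_double doubleK /=.
  by apply/existsP; exists r; rewrite Ar modn_small ?eqxx.
have rE : axis_point d r.*2 = shift r.*2 (axis_point d 0).
  by rewrite /shift /= addn0.
rewrite adm_r implybT /= visited_cat all_cat.
have := time_last (axis_point d 0) u; move: exc_u.
rewrite /excursion /intermediate => /and3P[u_gt0 + off].
have : 0 < size (visited (axis_point d 0) u) by rewrite size_visited.
rewrite rE visited_shift; move: off.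
case/lastP: (visited _ u) => // w y off _.
rewrite map_rcons !last_rcons /= add0n sz_u => /eqP y2 y1.
have -> : shift r.*2 y = axis_point d (r + i).*2.
  by rewrite /shift y1 y2 doubleD.
rewrite all_rcons -andbA; case: (_ ==> _) => //=.
suff -> : all (fun y => on_Taxis y ==> admissible A y) (map (shift r.*2) w) by [].
rewrite all_map; move: off; rewrite belast_rcons /=.
apply: sub_all => z /= off.
by rewrite /on_Taxis /= -/(on_Taxis z) (negPf off).
Qed.

(** [Sh t r q] is the representative of [q - r] modulo [t] in the range from 0 to [t - 1]. *)
Lemma eq_Sh (r q : 'I_t) i : (i %% t == Sh t r q) = ((r + i) %% t == q).
Proof.
have lt_r := ltn_ord r; have lt_q := ltn_ord q.
have lt_i : i %% t < t by rewrite ltn_mod; lia.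
rewrite -modnDmr /Sh; move: (i %% t) lt_i => k lt_k.
(* Both summands are below [t], so the sum wraps around at most once. *)
have -> : (r + k) %% t = if r + k < t then r + k else r + k - t.
  case: ltnP => [/modn_small // | le_t].
  by rewrite -{1}(subnK le_t) modnDr modn_small //; lia.
by apply/eqP/eqP; do 2 case: ifP; lia.
Qed.

(** * Recurrence for the numbers of paths *)

Definition count_good (m n : nat) := \sum_(s : n.*2.-tuple (step d)) good m s.

Definition count_excursion n := \sum_(s : n.*2.-tuple (step d)) excursion s.

Definition count_escape n := \sum_(s : n.*2.-tuple (step d))
  all (fun y => ~~ on_Taxis y) (visited (axis_point d 0) s).

(** If the residue of [r + i] lies in [A], exactly one term survives; otherwise the starting point
    is not admissible and both sides vanish. *)
Lemma count_good_mod (r : 'I_t) i n :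
  count_good (r + i) n =
  \sum_(q in A) (i %% t == Sh t r q) * count_good q n.
Proof.
have [[q Aq Eq] | no_q] := @exists_inP _ (mem A) (fun q => (r + i) %% t == q).
  rewrite (bigD1 q) //= eq_Sh Eq mul1n big1 ?addn0 => [|q' /andP[_ ne_q]].
    by apply: eq_bigr => s _; rewrite good_mod (eqP Eq).
  by rewrite eq_Sh (eqP Eq) eq_sym (inj_eq val_inj) (negPf ne_q).
rewrite {1}/count_good big1 => [|s _].
  rewrite big1 // => q Aq; rewrite eq_Sh; case: eqP => // Eq.
  by case: no_q; exists q => //; apply/eqP.
by apply/eqP; rewrite eqb0; apply: contra_notN no_q => /good_start/exists_inP.
Qed.

Lemma count_good_first_return (hd : 1 <= d) (r : 'I_t) n : r \in A ->
  count_good r n =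
  count_escape n + \sum_(i < n.+1) count_excursion i * count_good (r + i) (n - i).
Proof.
move=> Ar.
transitivity (count_escape n + \sum_(i < n.+1)
  \sum_(s : n.*2.-tuple (step d))
    excursion (take i.*2 s) * good (r + i) (drop i.*2 s)); last first.
  congr (_ + _); apply: eq_bigr => i _.
  apply: (sum_tuple_cat (fun s => excursion s : nat) (fun s => good (r + i) s)).
  by rewrite -doubleD subnKC // -ltnS.
(* With the sum over paths outermost, the identity is proved for each path [s] separately. *)
rewrite exchange_big -big_split; apply: eq_bigr => s _ /=.
have := first_return_sum hd (size_tuple s).
have -> : \sum_(i < n.+1) excursion (take i.*2 s) * good (r + i) (drop i.*2 s) =
          \sum_(i < n.+1) excursion (take i.*2 s) * good r s.
  apply: eq_bigr => i _; case: (boolP (excursion _)) => // exc.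
  have sz : size (take i.*2 s) = i.*2.
    by rewrite size_takel // size_tuple leq_double -ltnS.
  by rewrite -(good_excursion _ Ar sz exc) cat_take_drop.
(* An escaping path is good and has no excursion prefix; any other path has exactly one, which
   contributes [good r s]. *)
rewrite -big_distrl /=; case: (boolP (all _ _)) => [esc|_].
  by rewrite (good_escape Ar esc) muln1 => ->.
by rewrite !add0n => ->; rewrite mul1n.
Qed.

(** * Translation to power series; existence and uniqueness *)

Local Open Scope ring_scope.

Lemma P_seriesE (r : 'I_t) n : P_series d A r n = (count_good r n)%:R.
Proof. by rewrite /P_series /path_gf card_set_sum. Qed.

Lemma E_seriesE n : E_series d n = (count_excursion n)%:R.
Proof. by rewrite /E_series /path_gf card_set_sum. Qed.

Lemma Einf_seriesE n : Einf_series d n = (count_escape n)%:R.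
Proof. by rewrite /Einf_series /path_gf card_set_sum. Qed.

Lemma E_series0 : E_series d 0 = 0.
Proof.
rewrite E_seriesE /count_excursion big1 // => s _.
by rewrite /excursion size_tuple.
Qed.

Lemma P_series_solves (hd : (1 <= d)%N) : solves_system d A (P_series d A).
Proof.
move=> r Ar n /=; apply/eqP; rewrite subr_eq; apply/eqP.
rewrite P_seriesE Einf_seriesE (count_good_first_return hd n Ar) natrD.
congr (_ + _); rewrite natr_sum /fps_mul exchange_big /=.
apply: eq_bigr => i _; rewrite natrM count_good_mod natr_sum big_distrr /=.
apply: eq_bigr => q _; rewrite P_seriesE natrM mulrA; congr (_ * _).
by rewrite /multisection E_seriesE; case: eqP; rewrite ?mulr1 ?mulr0.
Qed.

Lemma solves_system_unique (X Y : 'I_t -> fps) :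
  solves_system d A X -> solves_system d A Y ->
  forall r, r \in A -> X r =1 Y r.
Proof.
move=> solX solY r Ar n; elim/ltn_ind: n r Ar => n IH r Ar.
have /eqP := solX r Ar n; rewrite -(solY r Ar n) /= => /eqP eqXY.
suff eqS : \sum_(q in A) fps_mul (multisection (E_series d) t (Sh t r q)) (X q) n =
    \sum_(q in A) fps_mul (multisection (E_series d) t (Sh t r q)) (Y q) n.
  by move: eqXY; rewrite eqS => /addIr.
(* The term of index 0 vanishes with the constant term of [E_series]; the others involve
   coefficients of index below [n]. *)
apply: eq_bigr => q Aq; apply: eq_bigr => -[[|i] lt_i] _ /=.
  by rewrite /multisection E_series0 if_same !mul0r.
by rewrite IH //; lia.
Qed.

End Admissible.

Theorem theorem1 (d t : nat) (hd : (1 <= d)%N) (ht : (1 <= t)%N)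
    (A : {set 'I_t}) (hA : Ordinal ht \in A) :
  solves_system d A (P_series d A) /\
  (forall X : 'I_t -> fps,
     solves_system d A X ->
     forall r : 'I_t, r \in A -> X r =1 P_series d A r).
Proof.
split=> [|X solX]; first exact: P_series_solves.
exact: (solves_system_unique solX (P_series_solves hd)).
Qed.
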